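(* Assume the setting described in the context and let $\beta<0$. Then the fixed point equation $$\rho(x)=\frac{\Upsilon(x)\exp\big(-\beta\int_{\mathbb{R}^2}\ln|x-y|\,\rho(y)\,dy+2H(x)\big)}{\int_{\mathbb{R}^2}\Upsilon(z)\exp\big(-\beta\int_{\mathbb{R}^2}\ln|z-y|\,\rho(y)\,dy+2H(z)\big)\,dz}$$ has at most one solution $\rho$ (so the solution $\rho_{\beta,H}$ is unique).
   Context: Let $\Upsilon\in L^\infty(\mathbb{R}^2)$, $\Upsilon\ge0$, $\Upsilon\not\equiv0$, and $H$ an entire harmonic function on $\mathbb{R}^2$ such that for every $0<\gamma<2$, $\int_{B_1(y)}\Upsilon(x)e^{2H(x)}|x-y|^{-\gamma}dx\to0$ as $|y|\to\infty$, and $\int\Upsilon(x)e^{2H(x)}|x|^qdx<\infty$ for some $q>0$. A solution means a probability density $\rho\ge0$ on $\mathbb{R}^2$ with finite logarithmic energy, $\int\int|\ln|x-y||\rho(x)\rho(y)\,dx\,dy<\infty$, for which the integrals in the equation are finite and the normalizing denominator is positive, satisfying the equation almost everywhere. *)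

(* Defs.v *)
From HB Require Import structures.
From mathcomp Require Import all_boot all_order all_algebra.
From mathcomp Require Import all_classical all_reals all_analysis.
Set Implicit Arguments. Unset Strict Implicit. Unset Printing Implicit Defensive.
Import Order.TTheory GRing.Theory Num.Theory.
Import numFieldNormedType.Exports.
Local Open Scope classical_set_scope.
Local Open Scope ring_scope.

Section Defs.
Variable R : realType.

Definition leb2 := ((@lebesgue_measure R) \x (@lebesgue_measure R))%E.

Definition enorm2 (x : R * R) : R := Num.sqrt (x.1 ^+ 2 + x.2 ^+ 2).
Definition edist2 (x y : R * R) : R := enorm2 (x.1 - y.1, x.2 - y.2).

Definition e1 : R * R := (1, 0).
Definition e2 : R * R := (0, 1).
Definition harmonic2 (H : R * R -> R) : Prop :=
  (forall x, differentiable H x) /\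
  (forall x, differentiable ('D_e1 H) x) /\
  (forall x, differentiable ('D_e2 H) x) /\
  (forall x, 'D_e1 ('D_e1 H) x + 'D_e2 ('D_e2 H) x = 0).

Definition logpot (rho : R * R -> R) (x : R * R) : R :=
  Rintegral leb2 setT (fun y => ln (edist2 x y) * rho y).

Definition gibbs (Ups H : R * R -> R) (beta : R) (rho : R * R -> R)
    (x : R * R) : R :=
  Ups x * expR (- beta * logpot rho x + 2 * H x).

Definition standing (Ups H : R * R -> R) : Prop :=
  [/\ measurable_fun setT Ups /\
        (exists M : R, {ae leb2, forall x, Ups x <= M}),
      {ae leb2, forall x, 0 <= Ups x} /\
        ~ {ae leb2, forall x, Ups x = 0},
      harmonic2 H,
      (forall gamma : R, 0 < gamma -> gamma < 2 ->
         forall eps : R, 0 < eps -> exists r : R, forall y : R * R,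
           r < enorm2 y ->
           (\int[leb2]_(x in [set x | (edist2 x y < 1)%R])
               (Ups x * expR (2 * H x) * powR (edist2 x y) (- gamma))%:E
             < eps%:E)%E) &
      (exists q : R, 0 < q /\
         (\int[leb2]_x (Ups x * expR (2 * H x) * powR (enorm2 x) q)%:E
           < +oo)%E)].

Definition is_solution (Ups H : R * R -> R) (beta : R) (rho : R * R -> R)
    : Prop :=
  [/\ measurable_fun setT rho /\ (forall x, 0 <= rho x),
      (\int[leb2]_x (rho x)%:E = 1)%E /\
      (\int[leb2]_x \int[leb2]_y
          (`|ln (edist2 x y)| * rho x * rho y)%:E < +oo)%E,
      {ae leb2, forall x, leb2.-integrable setT
          (fun y => (ln (edist2 x y) * rho y)%:E)},
      leb2.-integrable setT (fun z => (gibbs Ups H beta rho z)%:E) /\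
        0 < Rintegral leb2 setT (gibbs Ups H beta rho) &
      {ae leb2, forall x,
         rho x = gibbs Ups H beta rho x
                 / Rintegral leb2 setT (gibbs Ups H beta rho)}].

End Defs.

(* Main.v *)
Require Import Defs.
From HB Require Import structures.
From mathcomp Require Import all_boot all_order all_algebra.
From mathcomp Require Import all_classical all_reals all_analysis.
From mathcomp Require Import measurable_realfun ring lra.
Import Order.TTheory GRing.Theory Num.Theory.
Import numFieldNormedType.Exports.
Local Open Scope classical_set_scope.
Local Open Scope ring_scope.
Set Implicit Arguments.
Unset Strict Implicit.
Unset Printing Implicit Defensive.

(** Let [rho1], [rho2] be solutions and [sigma := rho1 - rho2], which has total
    mass [0]. Taking logarithms in the equation, [ln rho1 - ln rho2] is
    [- beta] times the logarithmic potential of [sigma], up to a constant.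
    Multiplying by [sigma] and integrating, a pointwise nonnegative quantity
    integrates to [- beta] times the logarithmic energy of [sigma]. As
    [beta < 0], it suffices that the logarithmic energy of a neutral density is
    nonpositive: the integrand then vanishes a.e., which forces
    [rho1 = rho2].

    For the sign of the energy, use the Frullani formula in the form
      [- ln a = int_R (exp (- e^s a) - exp (- e^s)) ds]
    with [a = |x - y|^2], and the fact that the Gaussian kernel
    [exp (- t |x - y|^2)] is positive definite: its power series expansion
    exhibits it as a bounded limit of sums of terms [g x * g y].

    Exchanging the integrals requires the mixed energy of [rho1] and [rho2] to
    be finite. The nonnegative kernel
      [ln (1 + a) - ln a = int_R exp (- e^s a) (1 - exp (- e^s)) ds]
    is again a mixture of Gaussians, so its mixed energy is dominated by the
    two self-energies; it differs from [|ln a|] by at most [ln (1 + a)], which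
    is controlled by the potentials at one point where both are finite. *)

(** * Product measures *)

Section product_sigma_finite.
Context d1 d2 (T1 : measurableType d1) (T2 : measurableType d2) (R : realType).
Variables (m1 : {sigma_finite_measure set T1 -> \bar R})
          (m2 : {sigma_finite_measure set T2 -> \bar R}).

(** Taking both exhausting sequences nondecreasing makes the diagonal rectangles [F n * G n] cover
    the product: a point in [F k * G n] lies in the rectangle of index [maxn n k]. *)
Lemma product_measure1_sigma_finite : sigma_finite setT (m1 \x m2)%E.
Proof.
have /sigma_finiteP[F [TF ndF Foo]] := sigma_finiteT m1.
have /sigma_finiteP[G [TG ndG Goo]] := sigma_finiteT m2.
exists (fun n => F n `*` G n); last first.
  move=> n; have [mF Fn] := Foo n; have [mG Gn] := Goo n.
  split; first exact: measurableX.
  by rewrite product_measure1E// lte_mul_pinfty// ge0_fin_numE.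
apply/seteqP; split => [[x y] _|//].
have : setT x by []; have : setT y by [].
rewrite TF TG => -[n _ Gy] [k _ Fx]; exists (maxn n k) => //; split => /=.
  by move: (x) Fx; exact/subsetPset/ndF/leq_maxr.
by move: (y) Gy; exact/subsetPset/ndG/leq_maxl.
Qed.

(* The canonical sigma-finite structure on [m1 \x m2] is only inferred for
   subprobabilities. *)
Definition prod_sfm : {sigma_finite_measure set (T1 * T2)%type -> \bar R} :=
  HB.pack_for {sigma_finite_measure set (T1 * T2)%type -> \bar R}
    (m1 \x m2)%E (Measure_isSigmaFinite.Build _ _ _ (m1 \x m2)%E
      product_measure1_sigma_finite).

End product_sigma_finite.

Section tensor_product.
Context d (T : measurableType d) (R : realType).
Variable m : {sigma_finite_measure set T -> \bar R}.
Implicit Types (f g : T -> R) (k : T * T -> R).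

Lemma integrable_tensor f g :
  m.-integrable setT (EFin \o f) -> m.-integrable setT (EFin \o g) ->
  (m \x m)%E.-integrable setT (fun p => (f p.1 * g p.2)%:E).
Proof.
move=> intf intg.
have /integrableP[/measurable_EFinP mf foo] := intf.
have /integrableP[/measurable_EFinP mg goo] := intg.
apply/integrable12ltyP.
  apply/measurable_EFinP/measurable_funM => /=.
    exact: (measurableT_comp mf).
  exact: (measurableT_comp mg).
under eq_integral.
  move=> x _; under eq_integral do rewrite /= normrM EFinM.
  rewrite ge0_integralZl//; last exact/measurable_EFinP/measurableT_comp.
  over.
rewrite ge0_integralZr//; last 2 first.
- exact/measurable_EFinP/measurableT_comp.
- exact: integral_ge0.
by rewrite lte_mul_pinfty// ?integral_ge0// ge0_fin_numE// integral_ge0.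
Qed.

Lemma integral_tensor f g :
  m.-integrable setT (EFin \o f) -> m.-integrable setT (EFin \o g) ->
  (\int[m \x m]_p (f p.1 * g p.2)%:E =
   \int[m]_x (f x)%:E * \int[m]_x (g x)%:E)%E.
Proof.
move=> intf intg.
rewrite -(integral12_prod_meas1 (integrable_tensor intf intg)) /fubini_F/=.
under eq_integral.
  move=> x _; under eq_integral do rewrite EFinM.
  rewrite integralZl//.
  over.
have gfin := integrable_fin_num measurableT intg.
by rewrite -(fineK gfin) integralZr.
Qed.

Lemma integrable_bounded_tensor k f g :
  measurable_fun setT k -> (forall p, `|k p| <= 1) ->
  m.-integrable setT (EFin \o f) -> m.-integrable setT (EFin \o g) ->
  (m \x m)%E.-integrable setT (fun p => (k p * (f p.1 * g p.2))%:E).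
Proof.
move=> mk k1 intf intg; have intfg := integrable_tensor intf intg.
have /integrableP[/measurable_EFinP mfg _] := intfg.
apply: le_integrable intfg => //.
  exact/measurable_EFinP/measurable_funM.
by move=> p _; rewrite lee_fin normrM ler_piMl.
Qed.

End tensor_product.

(** The product measure is the integral of the measures of the sections, so null sections give a
    null set. [P] is boolean so that its exceptional set is a measurable preimage. *)
Lemma ae_product (R : realType) d (T : measurableType d)
    (m : {sigma_finite_measure set T -> \bar R}) (P : T * T -> bool) :
  measurable_fun setT P -> (forall x, m [set y | ~~ P (x, y)] = 0%E) ->
  {ae (m \x m)%E, forall p, P p}.
Proof.
move=> mP m0.
have mN : measurable [set p | ~~ P p].
  rewrite (_ : [set p | ~~ P p] = P @^-1` [set false]).
    by rewrite -[X in measurable X]setTI; exact: mP.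
  by apply/seteqP; split => p /=; case: (P p).
exists [set p | ~~ P p]; split => //; last by move=> p /= /negP.
rewrite /product_measure1/= integral0_eq// => x _ /=.
rewrite (_ : xsection _ _ = [set y | ~~ P (x, y)])//.
by apply/seteqP; split => y /=; rewrite /xsection/= inE.
Qed.

(** Extracts an actual point from an almost everywhere statement: without one the whole space would
    be null and every integral would vanish. *)
Lemma ae_integral_neq0_ex (R : realType) d (T : measurableType d)
    (m : {measure set T -> \bar R}) (f : T -> \bar R) (P : T -> Prop) :
  measurable_fun setT f -> (\int[m]_x f x != 0)%E ->
  {ae m, forall x, P x} -> exists x, P x.
Proof.
move=> mf f0 [N [mN N0 PN]]; apply/not_existsP => nP.
have NT : N = setT by apply/seteqP; split => // x _; exact/PN/nP.
by move/eqP : f0; apply; rewrite null_set_integral// -NT.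
Qed.

(** * The Frullani formula *)

Lemma integral_xsection_ysection (R : realType) d1 d2
    (T1 : measurableType d1) (T2 : measurableType d2)
    (m1 : {sigma_finite_measure set T1 -> \bar R})
    (m2 : {sigma_finite_measure set T2 -> \bar R}) (A : set (T1 * T2)) :
  measurable A ->
  (\int[m1]_x m2 (xsection A x) = \int[m2]_y m1 (ysection A y))%E.
Proof.
move=> mA; have := indic_fubini_tonelli m1 m2 mA.
by rewrite indic_fubini_tonelli_FE// indic_fubini_tonelli_GE.
Qed.

(* Layer cake: the integrand is the length of the section at [s] of
   [{(s, z) | exp (- e^s b) < z <= exp (- e^s a)}], whose section at a height
   [0 < z < 1] is an interval of constant length [ln b - ln a]. *)
Lemma frullani_expR (R : realType) (a b : R) : 0 < a -> a <= b ->
  (\int[lebesgue_measure]_s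
     (expR (- (expR s * a)) - expR (- (expR s * b)))%:E)%E = (ln b - ln a)%:E.
Proof.
move=> a0 ab; have b0 : 0 < b by exact: lt_le_trans ab.
pose h (c s : R) := expR (- (expR s * c)).
have mh c : measurable_fun setT (h c).
  do 2 apply: measurableT_comp => //.
  by apply: measurable_funM.
pose A := [set p : R * R | h b p.1 < p.2 <= h a p.1].
have mA : measurable A.
  pose B (p : R * R) := (h b p.1 < p.2) && (p.2 <= h a p.1).
  rewrite (_ : A = B @^-1` [set true]).
    rewrite -[X in measurable X]setTI.
    suff : measurable_fun setT B by apply.
    apply: measurable_and.
      by apply: measurable_fun_ltr => //; apply: measurableT_comp.
    by apply: measurable_fun_ler => //; apply: measurableT_comp.
  by apply/seteqP; split.
have hlt s : h b s <= h a s.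
  by rewrite ler_expR lerN2 ler_wpM2l// expR_ge0.
have lab : ln a <= ln b by rewrite ler_ln.
transitivity (\int[lebesgue_measure]_s lebesgue_measure (xsection A s))%E.
  apply: eq_integral => s _; rewrite -/(h a s) -/(h b s) /=.
  rewrite (_ : xsection A s = `]h b s, h a s]%classic); last first.
    by apply/seteqP; split => z /=; rewrite /xsection/= inE/= in_itv.
  rewrite lebesgue_measure_itv/= lte_fin; have := hlt s.
  by rewrite le_eqVlt => /predU1P[->|->//]; rewrite ltxx subrr.
rewrite integral_xsection_ysection//.
transitivity (\int[lebesgue_measure]_z
    ((ln b - ln a)%:E * (\1_(`]0, 1[%classic : set R) z)%:E))%E; last first.
  have c0 : (0 <= (ln b - ln a)%:E)%E by rewrite lee_fin subr_ge0.
  rewrite ge0_integralZl//; last exact/measurable_EFinP/measurable_indic.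
  rewrite integral_indic// setIT/= lebesgue_measure_itv/= lte_fin ltr01.
  by rewrite sube0 mule1.
apply: eq_integral => z _ /=.
have [/andP[z0 z1]|z01] := boolP (0 < z < 1); last first.
  (* The section is empty here, since [0 <= h b s < z <= h a s < 1] would put [z] in the open unit
     interval. *)
  rewrite indicE memNset ?mule0/= ?in_itv//=; last exact/negP.
  rewrite (_ : ysection A z = set0) ?measure0//.
  apply/seteqP; split => s //=; rewrite /ysection/= inE/= => /andP[hz zh].
  move/negP: z01; apply; rewrite (le_lt_trans _ hz) ?expR_ge0//=.
  by rewrite (le_lt_trans zh)// expR_lt1 oppr_lt0 mulr_gt0// expR_gt0.
rewrite indicE mem_set; last by rewrite /= in_itv/= z0.
rewrite mule1.
have lz0 : 0 < - ln z by rewrite oppr_gt0 ln_lt0// z0.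
(* Taking logarithms twice solves for [s]: [z <= exp (- e^s a)] means [e^s a <= - ln z], that is
   [s <= ln (- ln z) - ln a]. *)
have secE s : (h b s < z <= h a s) =
    (s \in `]ln (- ln z) - ln b, ln (- ln z) - ln a]).
  rewrite in_itv/= ltrBlDr lerBrDr -[in RHS]ltr_expR -[in RHS]ler_expR !expRD.
  rewrite !lnK// -[in LHS](lnK z0) [in LHS]ltr_expR [in LHS]ler_expR.
  by rewrite ltrNl lerNr.
rewrite (_ : ysection A z =
    `]ln (- ln z) - ln b, ln (- ln z) - ln a]%classic); last first.
  by apply/seteqP; split => s /=; rewrite /ysection/= inE/= -secE.
rewrite lebesgue_measure_itv/= lte_fin ltrD2l ltrN2.
move: lab; rewrite le_eqVlt => /predU1P[->|lab]; first by rewrite ltxx subrr.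
by rewrite lab -EFinD; congr (_%:E); lra.
Qed.

Section log_kernel.
Variable R : realType.
Implicit Type a : R.

(* Since [ln 0 = 0], the bounds on [log_kernel] remain true at [a = 0]. *)
Definition log_kernel a := ln (1 + a) - ln a.

(** Compare [1 + a] with [2] when [a <= 1], and with [2 * a] when [a >= 1]. *)
Lemma ln1D_le a : 0 <= a -> ln (1 + a) <= ln 2 + `|ln a|.
Proof.
rewrite le_eqVlt => /predU1P[<-|a0].
  by rewrite addr0 ln1 addr_ge0// ln_ge0// ler1n.
have [a1|/ltW a1] := leP a 1.
  apply: (@le_trans _ _ (ln 2)); last by rewrite lerDl.
  by rewrite ler_ln ?posrE//; lra.
rewrite [`|_|]ger0_norm ?ln_ge0// -lnM ?posrE// ler_ln ?posrE//; lra.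
Qed.

Lemma log_kernel_ge0 a : 0 <= a -> 0 <= log_kernel a.
Proof.
rewrite le_eqVlt => /predU1P[<-|a0]; rewrite /log_kernel.
  by rewrite addr0 ln1 ln0// subrr.
by rewrite subr_ge0 ler_ln ?posrE//; lra.
Qed.

Lemma log_kernel_le a : 0 <= a -> log_kernel a <= ln 2 + `|ln a|.
Proof.
rewrite le_eqVlt => /predU1P[<-|a0]; rewrite /log_kernel.
  by rewrite addr0 ln1 ln0// subrr addr_ge0// ln_ge0// ler1n.
have [a1|/ltW a1] := leP a 1.
  by rewrite lerD//; [rewrite ler_ln ?posrE//; lra|rewrite -normrN ler_norm].
rewrite lerBlDr; apply: le_trans (ln1D_le (ltW a0)) _.
by rewrite lerDl ln_ge0.
Qed.

(** [ln a] is the difference of the nonnegative numbers [ln (1 + a)] and [log_kernel a]. *)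
Lemma norm_ln_le a : 0 <= a -> `|ln a| <= log_kernel a + ln (1 + a).
Proof.
move=> a0; have := log_kernel_ge0 a0.
have : 0 <= ln (1 + a) by rewrite ln_ge0// lerDl.
by rewrite /log_kernel ler_norml => h1 h2; apply/andP; split; lra.
Qed.

End log_kernel.

(* From here on the Frullani formula is a hypothesis on an abstract triple
   [(S, lam, e)], instantiated by [(R, lebesgue_measure, expR)] at the very end:
   the carrier of [lebesgue_measure] is not syntactically [R], which would block
   unification in the product measures below. *)
Section frullani.
Context dS (S : measurableType dS) (R : realType).
Variables (lam : {sigma_finite_measure set S -> \bar R}) (e : S -> R).
Hypothesis e_gt0 : forall s, 0 < e s.
Hypothesis frullani : forall a b : R, 0 < a -> a <= b ->
  (\int[lam]_s (expR (- (e s * a)) - expR (- (e s * b)))%:E)%E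
  = (ln b - ln a)%:E.
Implicit Type a : R.

(** The integrand has a constant sign, decided by comparing [a] with [1]. This absolute bound is
    what permits Fubini in the averages of [ln]. *)
Lemma frullani_norm a : 0 < a ->
  (\int[lam]_s
     `|expR (- (e s * a)) - expR (- e s)|%:E)%E = `|ln a|%:E.
Proof.
move=> a0; have [a1|/ltW a1] := leP a 1.
  rewrite ler0_norm ?ln_le0// -sub0r -[X in X - _]ln1 -frullani//.
  apply: eq_integral => s _; rewrite mulr1 ger0_norm// subr_ge0 ler_expR lerN2.
  by rewrite ger_pMr// e_gt0.
rewrite ger0_norm ?ln_ge0// -[X in X%:E]subr0 -[X in _ - X]ln1 -frullani//.
apply: eq_integral => s _; rewrite mulr1 distrC ger0_norm// subr_ge0.
by rewrite ler_expR lerN2 ler_pMr// e_gt0.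
Qed.

Lemma frullani_ln a : 0 < a ->
  (\int[lam]_s
     (expR (- (e s * a)) - expR (- e s))%:E)%E = (- ln a)%:E.
Proof.
move=> a0; have [a1|/ltW a1] := leP a 1.
  rewrite -sub0r -[X in X - _]ln1 -frullani//.
  by apply: eq_integral => s _; rewrite mulr1.
under eq_integral do rewrite -opprB EFinN.
rewrite integral_ge0N; last first.
  move=> s _; rewrite lee_fin subr_ge0.
  by rewrite ler_expR lerN2 ler_pMr// e_gt0.
rewrite EFinN -[X in (- X%:E)%E]subr0 -[X in _ - X]ln1 -frullani//.
by congr (- _)%E; apply: eq_integral => s _; rewrite mulr1.
Qed.

Lemma frullani_log_kernel a : 0 < a ->
  (\int[lam]_s
     (expR (- (e s * a)) * (1 - expR (- e s)))%:E)%E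
  = (log_kernel a)%:E.
Proof.
move=> a0; rewrite -frullani// ?lerDr//; apply: eq_integral => s _.
by rewrite mulrBr mulr1 -expRD -opprD mulrDr mulr1 [e s + _]addrC.
Qed.

End frullani.

(** * Logarithmic averages as mixtures of Gaussian averages *)

Section frullani_average.
Context dX (X : measurableType dX) dS (S : measurableType dS) (R : realType).
Variable M : {sigma_finite_measure set X -> \bar R}.
Variables (lam : {sigma_finite_measure set S -> \bar R}) (e : S -> R).
Hypotheses (me : measurable_fun setT e) (e_gt0 : forall s, 0 < e s).
Hypothesis frullani : forall a b : R, 0 < a -> a <= b ->
  (\int[lam]_s (expR (- (e s * a)) - expR (- (e s * b)))%:E)%E
  = (ln b - ln a)%:E.
Variables a phi : X -> R.
Hypotheses (ma : measurable_fun setT a) (mphi : measurable_fun setT phi).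
Hypothesis a_gt0 : {ae M, forall x, 0 < a x}.

Let mexp : measurable_fun setT (fun z : S * X => expR (- (e z.1 * a z.2))).
Proof.
do 2 apply: measurableT_comp => //; apply: measurable_funM.
  exact: (measurableT_comp me measurable_fst).
exact: (measurableT_comp ma measurable_snd).
Qed.

Let mexp1 : measurable_fun setT (fun z : S * X => expR (- e z.1)).
Proof. by do 2 apply: measurableT_comp => //; exact: measurableT_comp. Qed.

(** Fubini applies to a signed [phi] because integrating the absolute value in [s] first gives
    [|ln (a x) * phi x|], integrable by assumption. *)
Lemma integral_ln_average :
  M.-integrable setT (fun x => (ln (a x) * phi x)%:E) ->
  (\int[M]_x (ln (a x) * phi x)%:E =
   - \int[lam]_s \int[M]_x
       ((expR (- (e s * a x)) - expR (- e s)) * phi x)%:E)%E.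
Proof.
move=> intE; have /integrableP[mE Eoo] := intE.
pose g (z : S * X) : \bar R :=
  ((expR (- (e z.1 * a z.2)) - expR (- e z.1)) * phi z.2)%:E.
have mg : measurable_fun setT g.
  apply/measurable_EFinP/measurable_funM; first exact: measurable_funB.
  exact: (measurableT_comp mphi measurable_snd).
have mgs x : measurable_fun setT (fun s => expR (- (e s * a x)) - expR (- e s)).
  apply: measurable_funB.
    exact: (measurableT_comp mexp (pair2_measurable x)).
  exact: (measurableT_comp mexp1 (pair2_measurable x)).
have intg : (lam \x M)%E.-integrable setT g.
  apply/integrable21ltyP => //.
  rewrite (_ : (\int[_]_x _)%E = (\int[M]_x `|(ln (a x) * phi x)%:E|)%E)//.
  apply: ae_eq_integral => //.
  - apply: (@measurable_fun_fubini_tonelli_G _ _ _ _ _ lam (abse \o g)) => //.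
      exact: measurableT_comp.
    by move=> z; exact: abse_ge0.
  - exact: measurableT_comp.
  apply: filterS a_gt0 => x ax _; rewrite /g/=.
  under eq_integral do rewrite normrM EFinM.
  rewrite ge0_integralZr//; last first.
    exact/measurable_EFinP/measurableT_comp.
  by rewrite (frullani_norm e_gt0 frullani)// -EFinM -normrM.
have /esym := Fubini intg.
rewrite /fubini_F /fubini_G.
have -> : (\int[M]_x \int[lam]_s g (s, x) =
    \int[M]_x - (ln (a x) * phi x)%:E)%E.
  apply: ae_eq_integral => //.
  - exact: (measurable_fubini_G intg).
  - exact: measurableT_comp.
  apply: filterS a_gt0 => x ax _; rewrite /g/=.
  under eq_integral do rewrite EFinM.
  rewrite integralZr//.
    by rewrite (frullani_ln e_gt0 frullani)// -EFinM mulNr.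
  apply/integrableP; split; first exact/measurable_EFinP.
  by rewrite (frullani_norm e_gt0 frullani)// ltry.
rewrite integralN; last exact: integrable_add_def.
by move=> /eqP; rewrite eqe_oppLR => /eqP ->.
Qed.

(** Everything is nonnegative, so Tonelli gives the identity even when both sides are infinite; it
    can therefore serve to prove finiteness. *)
Lemma integral_log_kernel_average : (forall x, 0 <= phi x) ->
  (\int[M]_x (log_kernel (a x) * phi x)%:E =
   \int[lam]_s ((1 - expR (- e s))%:E *
     \int[M]_x (expR (- (e s * a x)) * phi x)%:E))%E.
Proof.
move=> phi0.
pose h (z : S * X) : \bar R := (expR (- (e z.1 * a z.2)) *
  (1 - expR (- e z.1)) * phi z.2)%:E.
have w0 s : 0 <= 1 - expR (- e s) :> R.
  by rewrite subr_ge0 expR_le1 oppr_le0 ltW.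
have mh : measurable_fun setT h.
  apply/measurable_EFinP/measurable_funM.
    by apply: measurable_funM => //; exact: measurable_funB.
  exact: (measurableT_comp mphi measurable_snd).
have h0 z : (0 <= h z)%E.
  by rewrite lee_fin !mulr_ge0// expR_ge0.
have mhs x : measurable_fun setT
    (fun s => expR (- (e s * a x)) * (1 - expR (- e s))).
  apply: measurable_funM.
    exact: (measurableT_comp mexp (pair2_measurable x)).
  apply: measurable_funB => //.
  exact: (measurableT_comp mexp1 (pair2_measurable x)).
transitivity (\int[M]_x \int[lam]_s h (s, x))%E.
  apply: ae_eq_integral => //.
  - apply/measurable_EFinP/measurable_funM => //; apply: measurable_funB.
      by apply: measurableT_comp => //; exact: measurable_funD.
    exact: measurableT_comp.
  - exact: (@measurable_fun_fubini_tonelli_G _ _ _ _ _ lam h).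
  apply: filterS a_gt0 => x ax _; rewrite /h/=.
  under eq_integral do rewrite EFinM.
  rewrite ge0_integralZr ?lee_fin//.
  + by rewrite (frullani_log_kernel frullani).
  + exact/measurable_EFinP.
  + by move=> s _; rewrite lee_fin mulr_ge0// expR_ge0.
rewrite -(@fubini_tonelli _ _ _ _ _ lam M h)//.
apply: eq_integral => s _; rewrite /h/=.
under eq_integral do rewrite -mulrA mulrCA EFinM.
rewrite ge0_integralZl ?lee_fin//.
- apply/measurable_EFinP/measurable_funM => //.
  exact: (measurableT_comp mexp (pair1_measurable s)).
- by move=> x _; rewrite lee_fin !mulr_ge0// expR_ge0.
Qed.

Lemma measurable_gaussian_average : (forall x, 0 <= phi x) ->
  measurable_fun setT (fun s => ((1 - expR (- e s))%:E *
     \int[M]_x (expR (- (e s * a x)) * phi x)%:E)%E).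
Proof.
move=> phi0; apply: emeasurable_funM.
  apply/measurable_EFinP; apply: measurable_funB => //.
  by do 2 apply: measurableT_comp => //.
pose h (z : S * X) : \bar R := (expR (- (e z.1 * a z.2)) * phi z.2)%:E.
apply: (@measurable_fun_fubini_tonelli_F _ _ _ _ _ M h).
  apply/measurable_EFinP/measurable_funM => //.
  exact: (measurableT_comp mphi measurable_snd).
by move=> z; rewrite lee_fin mulr_ge0// expR_ge0.
Qed.

End frullani_average.

(** * Positive definiteness of the Gaussian kernel *)

Section gaussian.
Variable R : realType.
Implicit Types (t s r : R).

(** Expanding [exp (2 t s r)] in powers writes [exp (- t (s - r)^2)] as a series whose [k]-th term
    is one function evaluated at [s] times the same function at [r]; the square root shares the
    coefficient between the two factors. *)
Definition gauss_coeff t k s : R :=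
  Num.sqrt ((2 * t) ^+ k / k`!%:R) * s ^+ k * expR (- (t * s ^+ 2)).

Definition gauss_sum t n s r : R :=
  \sum_(k < n) gauss_coeff t k s * gauss_coeff t k r.

Lemma gauss_sumE t n s r : 0 <= t -> gauss_sum t n s r =
  series (exp_coeff (2 * t * s * r)) n * expR (- (t * s ^+ 2 + t * r ^+ 2)).
Proof.
move=> t0; rewrite /series/= big_mkord mulr_suml; apply: eq_bigr => k _.
have c0 : 0 <= (2 * t) ^+ k / k`!%:R.
  by rewrite divr_ge0// exprn_ge0// mulr_ge0.
rewrite /gauss_coeff /exp_coeff/= opprD expRD.
have -> : (2 * t * s * r) ^+ k = (2 * t) ^+ k * s ^+ k * r ^+ k.
  by rewrite !exprMn.
set e1 := expR _; set e2 := expR _; set q := Num.sqrt _.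
have qE : q * q = (2 * t) ^+ k / k`!%:R by rewrite -expr2 sqr_sqrtr.
transitivity ((q * q) * (s ^+ k * r ^+ k) * (e1 * e2)); first by ring.
by rewrite qE; ring.
Qed.

Lemma series_exp_coeff_le s n : `|series (exp_coeff s) n| <= expR `|s|.
Proof.
apply: (@le_trans _ _ (series (exp_coeff `|s|) n)).
  rewrite /series/=; apply: le_trans (ler_norm_sum _ _ _) _.
  apply: ler_sum => k _.
  by rewrite /exp_coeff/= normrM normrX normfV normr_nat.
rewrite expRE/pseries -exp_coeffE.
apply: nondecreasing_cvgn_le; last exact: is_cvg_series_exp_coeff.
apply/nondecreasing_seqP => k; rewrite seriesSr lerDl.
by rewrite /exp_coeff/= divr_ge0// exprn_ge0.
Qed.

(** From [2 t |s r| <= t s^2 + t r^2]. Uniformity in [n] provides the domination in the passage to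
    the Gaussian kernel. *)
Lemma gauss_sum_le1 t n s r : 0 <= t -> `|gauss_sum t n s r| <= 1.
Proof.
move=> t0; rewrite gauss_sumE// normrM (ger0_norm (expR_ge0 _)).
rewrite expRN ler_pdivrMr ?expR_gt0// mul1r.
apply: le_trans (series_exp_coeff_le _ _) _; rewrite ler_expR ler_norml.
have := sqr_ge0 (s - r); have := sqr_ge0 (s + r).
move=> h1 h2.
have h1' := mulr_ge0 t0 h1; have h2' := mulr_ge0 t0 h2.
by apply/andP; split; lra.
Qed.

(** The square of the coefficient is one of the nonnegative terms of the diagonal sum
    [gauss_sum t k.+1 s s], which is at most [1]. *)
Lemma gauss_coeff_le1 t k s : 0 <= t -> `|gauss_coeff t k s| <= 1.
Proof.
move=> t0; rewrite -(@expr_le1 _ 2)// -normrX ger0_norm ?sqr_ge0//.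
apply: le_trans (gauss_sum_le1 k.+1 s s t0); rewrite ger0_norm.
  rewrite /gauss_sum big_ord_recr/= -expr2 lerDr.
  by apply: sumr_ge0 => i _; rewrite -expr2 sqr_ge0.
by apply: sumr_ge0 => i _; rewrite -expr2 sqr_ge0.
Qed.

Lemma gauss_sum_cvg t s r : 0 <= t ->
  gauss_sum t n s r @[n --> \oo] --> expR (- (t * (s - r) ^+ 2)).
Proof.
move=> t0; under eq_fun do rewrite gauss_sumE//.
have -> : - (t * (s - r) ^+ 2) =
    2 * t * s * r + - (t * s ^+ 2 + t * r ^+ 2) by ring.
rewrite expRD; apply: cvgM; last exact: cvg_cst.
rewrite expRE/pseries -exp_coeffE.
exact: is_cvg_series_exp_coeff.
Qed.

Lemma measurable_gauss_coeff t k : measurable_fun setT (gauss_coeff t k).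
Proof.
apply: measurable_funM.
  by apply: measurable_funM => //; exact: exprn_measurable.
do 2 apply: measurableT_comp => //; apply: measurable_funM => //.
Qed.

End gaussian.

Section gaussian_positive_definite.
Context d (T : measurableType d) (R : realType).
Variable m : {sigma_finite_measure set T -> \bar R}.
Variables u v : T -> R.
Hypotheses (mu : measurable_fun setT u) (mv : measurable_fun setT v).

Definition sqdist (p : T * T) : R :=
  (u p.1 - u p.2) ^+ 2 + (v p.1 - v p.2) ^+ 2.

Lemma sqdist_ge0 p : 0 <= sqdist p.
Proof. by rewrite addr_ge0// sqr_ge0. Qed.

Lemma measurable_sqdist : measurable_fun setT sqdist.
Proof.
apply: measurable_funD; apply: measurable_funX; apply: measurable_funB.
- exact: (measurableT_comp mu measurable_fst).
- exact: (measurableT_comp mu measurable_snd).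
- exact: (measurableT_comp mv measurable_fst).
- exact: (measurableT_comp mv measurable_snd).
Qed.

(** The planar Gaussian is a product of two one-dimensional ones. Truncating both series at [n]
    turns the energy into a finite sum of squares of the integrals of [g k l * f]; dominated
    convergence with bound [|f p.1 * f p.2|] concludes. *)
Lemma gaussian_energy_ge0 (t : R) (f : T -> R) : 0 <= t ->
  m.-integrable setT (EFin \o f) ->
  (0 <= \int[m \x m]_p (expR (- (t * sqdist p)) * (f p.1 * f p.2))%:E)%E.
Proof.
move=> t0 intf.
have /integrableP[/measurable_EFinP mf _] := intf.
pose g k l x := gauss_coeff t k (u x) * gauss_coeff t l (v x).
have mg k l : measurable_fun setT (g k l).
  by apply: measurable_funM; apply: measurableT_comp => //;
    exact: measurable_gauss_coeff.
have g1 k l x : `|g k l x| <= 1.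
  by rewrite normrM mulr_ile1// gauss_coeff_le1.
have intgf k l : m.-integrable setT (EFin \o (fun x => g k l x * f x)).
  apply: le_integrable intf => //; first exact/measurable_EFinP/measurable_funM.
  by move=> x _; rewrite lee_fin normrM ler_piMl.
pose G n (p : T * T) :=
  gauss_sum t n (u p.1) (u p.2) * gauss_sum t n (v p.1) (v p.2).
have GE n p : G n p * (f p.1 * f p.2) = \sum_(k < n) \sum_(l < n)
    (g k l p.1 * f p.1) * (g k l p.2 * f p.2).
  rewrite /G /gauss_sum mulr_suml mulr_suml; apply: eq_bigr => k _.
  rewrite mulr_sumr mulr_suml; apply: eq_bigr => l _.
  by rewrite /g; ring.
have intG n k : (m \x m)%E.-integrable setT (fun p : T * T =>
    (\sum_(l < n) ((g k l p.1 * f p.1) * (g k l p.2 * f p.2))%:E)%E).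
  apply: integrable_sum => // l _.
  exact: (integrable_tensor (intgf k l) (intgf k l)).
have cvgG : (\int[m \x m]_p (G n p * (f p.1 * f p.2))%:E)%E @[n --> \oo] -->
    (\int[m \x m]_p (expR (- (t * sqdist p)) * (f p.1 * f p.2))%:E)%E.
  apply: (@dominated_cvg _ _ _ _ _ measurableT _ _
    (fun p => `|f p.1 * f p.2|%:E)) => //.
  - move=> n; under eq_fun do rewrite GE -sumEFin.
    under eq_fun do under eq_bigr do rewrite -sumEFin.
    apply: emeasurable_sum => k; exact: (measurable_int _ (intG n k)).
  - move=> p _; apply/cvg_EFin; first exact: nearW.
    apply: cvgM; last exact: cvg_cst.
    rewrite /sqdist mulrDr opprD expRD.
    by apply: cvgM; exact: gauss_sum_cvg.
  - exact: integrable_norm (integrable_tensor intf intf).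
  - move=> n p _; rewrite lee_fin normrM ler_piMl// /G normrM.
    by rewrite mulr_ile1// gauss_sum_le1.
apply: (cvge_ge _ cvgG); apply: nearW => n.
under eq_integral do rewrite GE -sumEFin.
under eq_integral do under eq_bigr do rewrite -sumEFin.
rewrite integral_sum//; apply: sume_ge0 => k _.
rewrite integral_sum//; last first.
  by move=> l; exact: (integrable_tensor (intgf k l) (intgf k l)).
apply: sume_ge0 => l _; rewrite (integral_tensor (intgf _ _) (intgf _ _)).
rewrite -(fineK (integrable_fin_num measurableT (intgf k l))) -EFinM lee_fin.
by rewrite -expr2 sqr_ge0.
Qed.

End gaussian_positive_definite.

(** * Logarithmic energy *)

Section logarithmic_energy.
Context d (T : measurableType d) (R : realType).
Variable m : {sigma_finite_measure set T -> \bar R}.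
Variables u v : T -> R.
Hypotheses (mu : measurable_fun setT u) (mv : measurable_fun setT v).
Local Notation a := (sqdist u v).
Hypothesis a_gt0 : {ae (m \x m)%E, forall p, 0 < a p}.
Context dS (S : measurableType dS).
Variables (lam : {sigma_finite_measure set S -> \bar R}) (e : S -> R).
Hypotheses (me : measurable_fun setT e) (e_gt0 : forall s, 0 < e s).
Hypothesis frullani : forall a b : R, 0 < a -> a <= b ->
  (\int[lam]_s (expR (- (e s * a)) - expR (- (e s * b)))%:E)%E
  = (ln b - ln a)%:E.

Local Notation mm := (prod_sfm m m).

Let ma : measurable_fun setT a. Proof. exact: measurable_sqdist. Qed.

Let mlna : measurable_fun setT (fun p => ln (a p)).
Proof. exact: measurableT_comp. Qed.

Let mexp s : measurable_fun setT (fun p => expR (- (e s * a p))).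
Proof. by do 2 apply: measurableT_comp => //; exact: measurable_funM. Qed.

Let exp_le1 s p : `|expR (- (e s * a p))| <= 1.
Proof.
rewrite ger0_norm ?expR_ge0// expR_le1 oppr_le0.
by rewrite mulr_ge0// ?sqdist_ge0// ltW.
Qed.

Let mtensor (f g : T -> R) : measurable_fun setT f -> measurable_fun setT g ->
  measurable_fun setT (fun p : T * T => f p.1 * g p.2).
Proof.
move=> mf mg; apply: measurable_funM.
  exact: (measurableT_comp mf measurable_fst).
exact: (measurableT_comp mg measurable_snd).
Qed.

Let integrable_measurable (f : T -> R) :
  m.-integrable setT (EFin \o f) -> measurable_fun setT f.
Proof. by move=> /integrableP[/measurable_EFinP]. Qed.

(** In the average over [s], the subtracted term is [exp (- e s)] times the squared total mass,
    which is [0]; minus a nonnegative Gaussian energy remains. *)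
Lemma neutral_log_energy_le0 (f : T -> R) :
  m.-integrable setT (EFin \o f) -> (\int[m]_x (f x)%:E = 0)%E ->
  (m \x m)%E.-integrable setT (fun p => (ln (a p) * (f p.1 * f p.2))%:E) ->
  (\int[m \x m]_p (ln (a p) * (f p.1 * f p.2))%:E <= 0)%E.
Proof.
move=> intf f0 intE; have mf := integrable_measurable intf.
have intff := integrable_tensor intf intf.
rewrite (integral_ln_average (M := mm) me e_gt0 frullani ma
  (mtensor mf mf) a_gt0 intE).
rewrite oppe_le0; apply: integral_ge0 => s _.
under eq_integral do rewrite mulrBl EFinB.
rewrite integralB//.
- under [X in (_ - X)%E]eq_integral do rewrite EFinM.
  rewrite integralZl// (integral_tensor intf intf) f0 mule0 mule0 sube0.
  by apply: gaussian_energy_ge0 => //; exact: ltW.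
- exact: (integrable_bounded_tensor (mexp s) (exp_le1 s) intf intf).
- by under eq_fun do rewrite EFinM; exact: integrableZl.
Qed.

(** Positivity of the Gaussian energy of [f - g] bounds the sum of the two cross terms by the two
    self-energies; one cross term is then dropped, being nonnegative. *)
Lemma gaussian_mixed_energy_le (f g : T -> R) s :
  (forall x, 0 <= f x) -> (forall x, 0 <= g x) ->
  m.-integrable setT (EFin \o f) -> m.-integrable setT (EFin \o g) ->
  (\int[m \x m]_p (expR (- (e s * a p)) * (f p.1 * g p.2))%:E <=
   \int[m \x m]_p (expR (- (e s * a p)) * (f p.1 * f p.2))%:E +
   \int[m \x m]_p (expR (- (e s * a p)) * (g p.1 * g p.2))%:E)%E.
Proof.
move=> f0 g0 intf intg.
have intk (f1 g1 : T -> R) : m.-integrable setT (EFin \o f1) ->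
    m.-integrable setT (EFin \o g1) -> (m \x m)%E.-integrable setT
      (fun p => (expR (- (e s * a p)) * (f1 p.1 * g1 p.2))%:E).
  by move=> h1 h2; exact: (integrable_bounded_tensor (mexp s) (exp_le1 s) h1 h2).
pose h x := f x - g x.
have inth : m.-integrable setT (EFin \o h).
  by have := integrableB measurableT intf intg.
have := gaussian_energy_ge0 mu mv (ltW (e_gt0 s)) inth.
pose Q f1 g1 := (\int[m \x m]_p (expR (- (e s * a p)) * (f1 p.1 * g1 p.2))%:E)%E.
rewrite -/(Q h h) -/(Q f g) -/(Q f f) -/(Q g g).
have -> : Q h h = ((Q f f + Q g g) - (Q f g + Q g f))%E.
  rewrite /Q -!integralD//; try exact: intk.
  rewrite -integralB//; try (apply: integrableD => //; exact: intk).
  apply: eq_integral => p _; rewrite -!EFinD.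
  by congr (_%:E); rewrite /h; ring.
have Qfin f1 g1 : m.-integrable setT (EFin \o f1) ->
    m.-integrable setT (EFin \o g1) -> Q f1 g1 \is a fin_num.
  by move=> h1 h2; apply: integrable_fin_num => //; exact: intk.
have Qgf : (0 <= Q g f)%E.
  by apply: integral_ge0 => p _; rewrite lee_fin !mulr_ge0// expR_ge0.
rewrite sube_ge0; last by rewrite fin_numD !Qfin.
by apply: le_trans; rewrite leeDl.
Qed.

Lemma integrable_log_kernel (f : T -> R) :
  (forall x, 0 <= f x) -> m.-integrable setT (EFin \o f) ->
  (m \x m)%E.-integrable setT (fun p => (ln (a p) * (f p.1 * f p.2))%:E) ->
  (m \x m)%E.-integrable setT
    (fun p => (log_kernel (a p) * (f p.1 * f p.2))%:E).
Proof.
move=> f0 intf intE; have mf := integrable_measurable intf.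
have intB : (m \x m)%E.-integrable setT (fun p =>
    ((ln 2)%:E * (f p.1 * f p.2)%:E + `|(ln (a p) * (f p.1 * f p.2))%:E|)%E).
  apply: integrableD => //; last exact: integrable_abse.
  by apply: integrableZl => //; exact: integrable_tensor.
apply: le_integrable intB => //.
  apply/measurable_EFinP/measurable_funM; last exact: mtensor.
  apply: measurable_funB => //; apply: measurableT_comp => //.
  exact: measurable_funD.
move=> p _; have ff0 : 0 <= f p.1 * f p.2 by exact: mulr_ge0.
rewrite lee_fin [leRHS]ger0_norm; last first.
  by rewrite addr_ge0// mulr_ge0// ln_ge0// ler1n.
rewrite !normrM (ger0_norm (log_kernel_ge0 (sqdist_ge0 _ _ _))).
rewrite [`|f p.1|]ger0_norm// [`|f p.2|]ger0_norm// -mulrDl ler_wpM2r//.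
by rewrite log_kernel_le// sqdist_ge0.
Qed.

(** Writing all three energies as averages over [s] with the common weight [1 - exp (- e s) >= 0]
    reduces the bound to the Gaussian one for each [s]. *)
Lemma integrable_mixed_log_kernel (f g : T -> R) :
  (forall x, 0 <= f x) -> (forall x, 0 <= g x) ->
  m.-integrable setT (EFin \o f) -> m.-integrable setT (EFin \o g) ->
  (m \x m)%E.-integrable setT (fun p => (ln (a p) * (f p.1 * f p.2))%:E) ->
  (m \x m)%E.-integrable setT (fun p => (ln (a p) * (g p.1 * g p.2))%:E) ->
  (m \x m)%E.-integrable setT
    (fun p => (log_kernel (a p) * (f p.1 * g p.2))%:E).
Proof.
move=> f0 g0 intf intg intEf intEg.
have mf := integrable_measurable intf; have mg := integrable_measurable intg.
have Kf := integrable_log_kernel f0 intf intEf.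
have Kg := integrable_log_kernel g0 intg intEg.
apply/integrableP; split.
  apply/measurable_EFinP/measurable_funM; last exact: mtensor.
  apply: measurable_funB => //; apply: measurableT_comp => //.
  exact: measurable_funD.
have ff0 p : 0 <= f p.1 * f p.2 by exact: mulr_ge0.
have gg0 p : 0 <= g p.1 * g p.2 by exact: mulr_ge0.
have fg0 p : 0 <= f p.1 * g p.2 by exact: mulr_ge0.
under eq_integral.
  move=> p _; rewrite gee0_abs; last first.
    by rewrite lee_fin mulr_ge0// log_kernel_ge0// sqdist_ge0.
  over.
rewrite (integral_log_kernel_average (M := mm) me e_gt0 frullani ma
  (mtensor mf mg) a_gt0 fg0).
have Koo := lte_add_pinfty (integrable_lty measurableT Kf)
  (integrable_lty measurableT Kg).
apply: le_lt_trans Koo.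
rewrite (integral_log_kernel_average (M := mm) me e_gt0 frullani ma
  (mtensor mf mf) a_gt0 ff0).
rewrite (integral_log_kernel_average (M := mm) me e_gt0 frullani ma
  (mtensor mg mg) a_gt0 gg0).
have w0 s : 0 <= 1 - expR (- e s) :> R.
  by rewrite subr_ge0 expR_le1 oppr_le0 ltW.
have Qge0 (phi : T * T -> R) s : (forall p, 0 <= phi p) ->
    (0 <= (1 - expR (- e s))%:E *
      \int[mm]_p (expR (- (e s * a p)) * phi p)%:E)%E.
  move=> phi0; rewrite mule_ge0 ?lee_fin//.
  by apply: integral_ge0 => p _; rewrite lee_fin mulr_ge0// expR_ge0.
have mQ (f1 g1 : T -> R) (mf1 : measurable_fun setT f1)
    (mg1 : measurable_fun setT g1)
    (h0 : forall p : T * T, 0 <= f1 p.1 * g1 p.2) :=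
  measurable_gaussian_average mm me ma (mtensor mf1 mg1) h0.
rewrite -ge0_integralD//; last 4 first.
- by move=> s _; exact: Qge0.
- exact: mQ.
- by move=> s _; exact: Qge0.
- exact: mQ.
apply: ge0_le_integral => //.
- by move=> s _; exact: Qge0.
- exact: mQ.
- by apply: emeasurable_funD; exact: mQ.
move=> s _; rewrite -ge0_muleDr; last 2 first.
- by apply: integral_ge0 => p _; rewrite lee_fin mulr_ge0// expR_ge0.
- by apply: integral_ge0 => p _; rewrite lee_fin mulr_ge0// expR_ge0.
by apply: lee_wpmul2l; [rewrite lee_fin|exact: gaussian_mixed_energy_le].
Qed.

(** From [|x - y|^2 <= 2 |w - x|^2 + 2 |w - y|^2]. The right-hand side separates the variables [p.1]
    and [p.2]. *)
Lemma sqdist_quasi_triangle (w : T) (p : T * T) :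
  ln (1 + a p) <= ln 2 + ln (1 + a (w, p.1)) + ln (1 + a (w, p.2)).
Proof.
have a0 := sqdist_ge0 u v.
have a1 q : 0 < 1 + a q by rewrite ltr_pwDl.
rewrite -!lnM ?posrE// ?mulr_gt0// ler_ln ?posrE ?mulr_gt0//.
have := mulr_ge0 (a0 (w, p.1)) (a0 (w, p.2)).
suff : a p <= 2 * (a (w, p.1) + a (w, p.2)) by move=> h1 h2; lra.
have := sqr_ge0 ((u w - u p.1) + (u w - u p.2)).
have := sqr_ge0 ((v w - v p.1) + (v w - v p.2)).
by rewrite /sqdist/= => h1 h2; lra.
Qed.

Lemma integrable_ln1D (f : T -> R) (w : T) :
  (forall x, 0 <= f x) -> m.-integrable setT (EFin \o f) ->
  m.-integrable setT (fun y => (ln (a (w, y)) * f y)%:E) ->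
  m.-integrable setT (EFin \o (fun y => ln (1 + a (w, y)) * f y)).
Proof.
move=> f0 intf intw; have mf := integrable_measurable intf.
have maw : measurable_fun setT (fun y => a (w, y)).
  exact: (measurableT_comp ma (pair1_measurable w)).
have intB : m.-integrable setT (fun y =>
    ((ln 2)%:E * (f y)%:E + `|(ln (a (w, y)) * f y)%:E|)%E).
  by apply: integrableD => //; [exact: integrableZl|exact: integrable_abse].
apply: le_integrable intB => //.
  apply/measurable_EFinP/measurable_funM => //; apply: measurableT_comp => //.
  exact: measurable_funD.
move=> y _; have aw := sqdist_ge0 u v (w, y).
have l0 : 0 <= ln (1 + a (w, y)) by rewrite ln_ge0// lerDl.
rewrite lee_fin [leRHS]ger0_norm; last first.
  by rewrite addr_ge0// mulr_ge0// ln_ge0// ler1n.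
by rewrite !normrM (ger0_norm l0) (ger0_norm (f0 y)) -mulrDl ler_wpM2r// ln1D_le.
Qed.

(** [|ln a|] is at most [log_kernel a + ln (1 + a)]. The first part has finite mixed energy; the
    second is split through the base point [w] into tensor products of integrable functions. *)
Lemma integrable_mixed_log_energy (f g : T -> R) (w : T) :
  (forall x, 0 <= f x) -> (forall x, 0 <= g x) ->
  m.-integrable setT (EFin \o f) -> m.-integrable setT (EFin \o g) ->
  (m \x m)%E.-integrable setT (fun p => (ln (a p) * (f p.1 * f p.2))%:E) ->
  (m \x m)%E.-integrable setT (fun p => (ln (a p) * (g p.1 * g p.2))%:E) ->
  m.-integrable setT (fun y => (ln (a (w, y)) * f y)%:E) ->
  m.-integrable setT (fun y => (ln (a (w, y)) * g y)%:E) ->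
  (m \x m)%E.-integrable setT (fun p => (ln (a p) * (f p.1 * g p.2))%:E).
Proof.
move=> f0 g0 intf intg intEf intEg fw gw.
have mf := integrable_measurable intf; have mg := integrable_measurable intg.
have Kfg := integrable_mixed_log_kernel f0 g0 intf intg intEf intEg.
have lf := integrable_ln1D f0 intf fw; have lg := integrable_ln1D g0 intg gw.
have intB : (m \x m)%E.-integrable setT (fun p : T * T =>
    ((log_kernel (a p) * (f p.1 * g p.2))%:E + ((ln 2)%:E * (f p.1 * g p.2)%:E +
     ((ln (1 + a (w, p.1)) * f p.1 * g p.2)%:E +
      (f p.1 * (ln (1 + a (w, p.2)) * g p.2))%:E)))%E).
  apply: integrableD => //; apply: integrableD => //.
    by apply: integrableZl => //; exact: integrable_tensor.
  apply: integrableD => //.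
    exact: (integrable_tensor lf intg).
  exact: (integrable_tensor intf lg).
apply: le_integrable intB => //.
  by apply/measurable_EFinP/measurable_funM => //; exact: mtensor.
move=> p _; have a0 := sqdist_ge0 u v.
have l0 q : 0 <= ln (1 + a q) by rewrite ln_ge0// lerDl.
have fg0 : 0 <= f p.1 * g p.2 by exact: mulr_ge0.
rewrite -!EFinM -!EFinD lee_fin normrM (ger0_norm fg0).
rewrite (_ : _ * _ + _ = (log_kernel (a p) + (ln 2 + ln (1 + a (w, p.1)) +
  ln (1 + a (w, p.2)))) * (f p.1 * g p.2)); last by ring.
have ln20 : 0 <= ln 2 :> R by rewrite ln_ge0// ler1n.
have h : `|ln (a p)| <= log_kernel (a p) + (ln 2 + ln (1 + a (w, p.1)) +
    ln (1 + a (w, p.2))).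
  by apply: le_trans (norm_ln_le (a0 p)) _; rewrite lerD2l sqdist_quasi_triangle.
rewrite [leRHS]ger0_norm; last by rewrite mulr_ge0// (le_trans _ h).
exact: ler_wpM2r.
Qed.


(* The left-hand side integrates to [b] times the logarithmic energy of [f],
   which is nonpositive. *)
Lemma neutral_monotone_ae0 (f : T -> R) (b c : R) :
  let V x := Rintegral m setT (fun y => ln (a (x, y)) * f y) in
  0 <= b -> m.-integrable setT (EFin \o f) -> (\int[m]_x (f x)%:E = 0)%E ->
  (m \x m)%E.-integrable setT (fun p => (ln (a p) * (f p.1 * f p.2))%:E) ->
  {ae m, forall x, m.-integrable setT (fun y => (ln (a (x, y)) * f y)%:E)} ->
  {ae m, forall x, 0 <= f x * (b * V x - c)} ->
  {ae m, forall x, f x * (b * V x - c) = 0}.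
Proof.
move=> V b0 intf f0 intE aeint aepos.
pose F := fubini_F m (fun p : T * T => (ln (a p) * (f p.1 * f p.2))%:E).
have intF : m.-integrable setT F by exact: integrable_fubini_F.
(* [P] equals the product in the conclusion almost everywhere, and is built from [F] because Fubini
   makes [F] integrable. *)
pose P x := (b%:E * F x - c%:E * (f x)%:E)%E.
have intbF : m.-integrable setT (fun x => b%:E * F x)%E by exact: integrableZl.
have intcf : m.-integrable setT (fun x => c%:E * (f x)%:E)%E.
  exact: integrableZl.
have intP : m.-integrable setT P by exact: integrableB.
have /integrableP[mP _] := intP.
have PE : {ae m, forall x, P x = (f x * (b * V x - c))%:E}.
  apply: filterS aeint => x intx.
  have FE : F x = ((f x)%:E * (V x)%:E)%E.
    rewrite /F /fubini_F/=.
    under eq_integral do rewrite mulrCA EFinM.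
    rewrite integralZl// /V /Rintegral fineK//.
    exact: integrable_fin_num.
  by rewrite /P FE -!EFinM -EFinB; congr (_%:E); ring.
(* [P] is nonnegative almost everywhere, while neutrality removes the constant [c] and leaves [b]
   times a nonpositive energy as its integral. *)
have Pabs : (\int[m]_x `|P x| = 0)%E.
  apply/eqP; rewrite eq_le integral_ge0 ?andbT//.
  rewrite (_ : (\int[m]_x _)%E = (\int[m]_x P x)%E); last first.
    apply: ae_eq_integral => //; first exact: measurableT_comp.
    apply: filterS2 PE aepos => x Px x0 _; rewrite gee0_abs//.
    by rewrite Px lee_fin.
  rewrite integralB// integralZl// integralZl// f0 mule0 sube0.
  apply: mule_ge0_le0; first by rewrite lee_fin.
  rewrite (integral12_prod_meas1 intE).
  exact: neutral_log_energy_le0.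
have := (ae_eq_integral_abs m measurableT mP).1 Pabs.
by apply: filterS2 PE => x -> /(_ I) [].
Qed.

End logarithmic_energy.


(** * Solutions of the fixed point equation *)

Section log_gas.
Context d (T : measurableType d) (R : realType).
Variable m : {sigma_finite_measure set T -> \bar R}.
Variables u v : T -> R.
Local Notation a := (sqdist u v).
Variables (Ups H : T -> R) (beta : R).
Implicit Type rho : T -> R.

(* [logpot], [gibbs] and [is_solution] over an abstract measure space with two
   real coordinates; for [R * R] they unfold to the originals. *)
Definition gas_dist (x y : T) : R := Num.sqrt (a (x, y)).

Definition gas_potential rho (x : T) : R :=
  Rintegral m setT (fun y => ln (gas_dist x y) * rho y).

Definition gas_gibbs rho (x : T) : R :=
  Ups x * expR (- beta * gas_potential rho x + 2 * H x).

Definition gas_solution rho : Prop :=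
  [/\ measurable_fun setT rho /\ (forall x, 0 <= rho x),
      (\int[m]_x (rho x)%:E = 1)%E /\
      (\int[m]_x \int[m]_y
          (`|ln (gas_dist x y)| * rho x * rho y)%:E < +oo)%E,
      {ae m, forall x, m.-integrable setT
          (fun y => (ln (gas_dist x y) * rho y)%:E)},
      0 < Rintegral m setT (gas_gibbs rho) &
      {ae m, forall x,
         rho x = gas_gibbs rho x / Rintegral m setT (gas_gibbs rho)}].

Hypotheses (mu : measurable_fun setT u) (mv : measurable_fun setT v).
Hypothesis a_gt0 : {ae (m \x m)%E, forall p, 0 < a p}.
Context dS (S : measurableType dS).
Variables (lam : {sigma_finite_measure set S -> \bar R}) (e : S -> R).
Hypotheses (me : measurable_fun setT e) (e_gt0 : forall s, 0 < e s).
Hypothesis frullani : forall a b : R, 0 < a -> a <= b ->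
  (\int[lam]_s (expR (- (e s * a)) - expR (- (e s * b)))%:E)%E
  = (ln b - ln a)%:E.

Let ma : measurable_fun setT a. Proof. exact: measurable_sqdist. Qed.

Lemma ln_gas_dist x y : ln (gas_dist x y) = 2^-1 * ln (a (x, y)).
Proof. by rewrite -ln_powR powR12_sqrt// sqdist_ge0. Qed.

Lemma gas_solution_integrable rho : gas_solution rho ->
  m.-integrable setT (EFin \o rho).
Proof.
move=> [[mr r0] [r1 _] _ _ _].
apply/integrableP; split; first exact/measurable_EFinP.
by under eq_integral => x _ do rewrite /= ger0_norm//; rewrite r1 ltry.
Qed.

(** Finite energy is given as an iterated integral of absolute values; Tonelli turns it into
    integrability on the product. The factor [2] passes from the distance to its square. *)
Lemma gas_solution_energy rho : gas_solution rho ->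
  (m \x m)%E.-integrable setT (fun p => (ln (a p) * (rho p.1 * rho p.2))%:E).
Proof.
move=> sol; have intr := gas_solution_integrable sol.
have /integrableP[/measurable_EFinP mrr _] := integrable_tensor intr intr.
case: sol => -[_ r0] [_ Eoo] _ _ _.
have mh : measurable_fun setT
    (fun p : T * T => (ln (gas_dist p.1 p.2) * (rho p.1 * rho p.2))%:E).
  apply/measurable_EFinP/measurable_funM => //.
  under eq_fun do rewrite ln_gas_dist -surjective_pairing.
  by apply: measurable_funM => //; exact: measurableT_comp.
have inth : (m \x m)%E.-integrable setT
    (fun p : T * T => (ln (gas_dist p.1 p.2) * (rho p.1 * rho p.2))%:E).
  apply/integrable12ltyP => //; move: Eoo; congr (_ < _)%E.
  apply: eq_integral => x _; apply: eq_integral => y _ /=.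
  by rewrite !normrM (ger0_norm (r0 x)) (ger0_norm (r0 y)) mulrA.
rewrite (_ : (fun p => _) = (fun p : T * T =>
    2%:E * (ln (gas_dist p.1 p.2) * (rho p.1 * rho p.2))%:E)%E).
  exact: integrableZl.
apply/funext => p; rewrite -EFinM ln_gas_dist -surjective_pairing.
by congr (_%:E); lra.
Qed.

Lemma gas_solution_potential rho : gas_solution rho ->
  {ae m, forall x, m.-integrable setT (fun y => (ln (a (x, y)) * rho y)%:E) /\
   gas_potential rho x = 2^-1 * Rintegral m setT (fun y => ln (a (x, y)) * rho y)}.
Proof.
move=> [_ _ aei _ _]; apply: filterS aei => x intx.
have intx' : m.-integrable setT (fun y => (ln (a (x, y)) * rho y)%:E).
  rewrite (_ : (fun y => _) =
      (fun y => 2%:E * (ln (gas_dist x y) * rho y)%:E)%E).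
    exact: integrableZl.
  by apply/funext => y; rewrite -EFinM ln_gas_dist; congr (_%:E); lra.
split => //; rewrite -RintegralZl//.
by apply: eq_Rintegral => y _; rewrite ln_gas_dist mulrA.
Qed.

(** The normalizing constant moves into the exponent as [l], so that two solutions differ only
    through their exponents. *)
Lemma gas_solution_gibbs rho : {ae m, forall x, 0 <= Ups x} ->
  gas_solution rho ->
  exists l : R, {ae m, forall x, 0 <= Ups x /\ rho x = Ups x *
    expR (- beta * gas_potential rho x + 2 * H x - l)}.
Proof.
move=> Ups0 [_ _ _ Z0 eqr]; exists (ln (Rintegral m setT (gas_gibbs rho))).
apply: filterS2 Ups0 eqr => x U0 ->; split => //.
by rewrite /gas_gibbs expRB lnK ?posrE// mulrA.
Qed.

Lemma gas_solution_unique rho1 rho2 :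
  {ae m, forall x, 0 <= Ups x} -> beta < 0 ->
  gas_solution rho1 -> gas_solution rho2 ->
  {ae m, forall x, rho1 x = rho2 x}.
Proof.
move=> Ups0 b0 sol1 sol2.
have int1 := gas_solution_integrable sol1.
have int2 := gas_solution_integrable sol2.
have E1 := gas_solution_energy sol1; have E2 := gas_solution_energy sol2.
have V1 := gas_solution_potential sol1; have V2 := gas_solution_potential sol2.
have [l1 G1] := gas_solution_gibbs Ups0 sol1.
have [l2 G2] := gas_solution_gibbs Ups0 sol2.
case: sol1 => -[mr1 r10] [r11 _] _ _ _; case: sol2 => -[mr2 r20] [r21 _] _ _ _.
(* The base point: both potentials converge almost everywhere, and the space is not null since
   [rho1] has integral [1]. *)
have [w [w1 w2]] : exists w,
    m.-integrable setT (fun y => (ln (a (w, y)) * rho1 y)%:E) /\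
    m.-integrable setT (fun y => (ln (a (w, y)) * rho2 y)%:E).
  apply: (@ae_integral_neq0_ex R _ _ m (EFin \o rho1)).
  - exact/measurable_EFinP.
  - by rewrite /= r11 oner_neq0.
  - by apply: filterS2 V1 V2 => x [? _] [].
have E12 := integrable_mixed_log_energy mu mv a_gt0 me e_gt0 frullani
  r10 r20 int1 int2 E1 E2 w1 w2.
have E21 := integrable_mixed_log_energy mu mv a_gt0 me e_gt0 frullani
  r20 r10 int2 int1 E2 E1 w2 w1.
pose sigma x := rho1 x - rho2 x.
have ints : m.-integrable setT (EFin \o sigma).
  by have := integrableB measurableT int1 int2.
have sigma0 : (\int[m]_x (sigma x)%:E = 0)%E.
  under eq_integral do rewrite EFinB.
  by rewrite integralB// r11 r21 subee.
have Es : (m \x m)%E.-integrable setT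
    (fun p => (ln (a p) * (sigma p.1 * sigma p.2))%:E).
  rewrite (_ : (fun p => _) = (fun p : T * T =>
     ((ln (a p) * (rho1 p.1 * rho1 p.2))%:E
     + (ln (a p) * (rho2 p.1 * rho2 p.2))%:E)
     - ((ln (a p) * (rho1 p.1 * rho2 p.2))%:E
     + (ln (a p) * (rho2 p.1 * rho1 p.2))%:E))%E).
    by apply: integrableB => //; exact: integrableD.
  by apply/funext => p; rewrite -!EFinD; congr (_%:E); rewrite /sigma; ring.
pose V x := Rintegral m setT (fun y => ln (a (x, y)) * sigma y).
have aeV : {ae m, forall x,
    m.-integrable setT (fun y => (ln (a (x, y)) * sigma y)%:E) /\
    V x = 2 * (gas_potential rho1 x - gas_potential rho2 x)}.
  apply: filterS2 V1 V2 => x [i1 p1] [i2 p2]; split.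
    rewrite (_ : (fun y => _) = (fun y => (ln (a (x, y)) * rho1 y)%:E -
        (ln (a (x, y)) * rho2 y)%:E)%E); first exact: integrableB.
    by apply/funext => y; rewrite -EFinB mulrBr.
  rewrite p1 p2 -mulrBr -RintegralB// mulrA divff// mul1r.
  by apply: eq_Rintegral => y _; rewrite mulrBr.
(* The halved coefficient compensates for [V] using the logarithm of the squared distance; the
   external field [h] cancels. *)
have alg (b p1 p2 h : R) : - b / 2 * (2 * (p1 - p2)) - (l1 - l2) =
    (- b * p1 + 2 * h - l1) - (- b * p2 + 2 * h - l2) by field.
have aeG : {ae m, forall x, exists s1 s2 : R,
    [/\ 0 <= Ups x, sigma x = Ups x * (expR s1 - expR s2) &
     - beta / 2 * V x - (l1 - l2) = s1 - s2]}.
  apply: filterS3 aeV G1 G2 => x [_ VE] [U0 e1] [_ e2].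
  exists (- beta * gas_potential rho1 x + 2 * H x - l1).
  exists (- beta * gas_potential rho2 x + 2 * H x - l2).
  split; [exact: U0|by rewrite /sigma e1 e2 mulrBr|rewrite VE; exact: alg].
have b2 : 0 <= - beta / 2 by lra.
have main : {ae m, forall x, sigma x * (- beta / 2 * V x - (l1 - l2)) = 0}.
  apply: (neutral_monotone_ae0 mu mv a_gt0 me e_gt0 frullani b2 ints sigma0 Es).
    by apply: filterS aeV => x [].
  (* As [expR] is increasing, [expR s1 - expR s2] and [s1 - s2] have the same sign. *)
  apply: filterS aeG => x [s1 [s2 [U0 -> ]]]; rewrite -/V => ->.
  rewrite -mulrA mulr_ge0//.
  have [s12|/ltW s12] := leP s1 s2; last by rewrite mulr_ge0// subr_ge0// ler_expR.
  by rewrite mulr_le0// subr_le0// ler_expR.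
(* A zero product means that [sigma] vanishes or that the exponents agree, and equal exponents make
   [sigma] vanish as well. *)
apply: filterS2 aeG main => x [s1 [s2 [U0 sE ->]]] /eqP.
rewrite mulf_eq0 => /orP[/eqP|]; first by move/subr0_eq.
rewrite subr_eq0 => /eqP s12; apply: subr0_eq.
by move: sE; rewrite s12 subrr mulr0.
Qed.

End log_gas.

(** * Specialization to the plane *)

Section plane.
Variable R : realType.
Local Notation leb := (@lebesgue_measure R).
Local Notation T := (measurableTypeR R * measurableTypeR R)%type.
Local Notation m2 := (prod_sfm leb leb).
Local Notation a := (sqdist (fst : T -> R) (snd : T -> R)).

Let mfst : measurable_fun setT (fst : T -> R). Proof. exact: measurable_fst. Qed.
Let msnd : measurable_fun setT (snd : T -> R). Proof. exact: measurable_snd. Qed.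

(** The exceptional set is the diagonal, whose section at [x] is the single point [x], a null
    rectangle. *)
Lemma ae_sqdist_gt0 : {ae (m2 \x m2)%E, forall p, 0 < a p}.
Proof.
apply: ae_product.
  by apply: measurable_fun_ltr => //; exact: measurable_sqdist.
move=> x.
rewrite (_ : [set y | _] = [set x.1] `*` [set x.2]).
  rewrite [LHS]product_measure1E// [X in (X * _)%E]lebesgue_measure_set1.
  by rewrite mul0e.
apply/seteqP; split => [[y1 y2]|[y1 y2] [/= -> ->]]; rewrite /sqdist/=; last first.
  by rewrite !subrr expr0n/= addr0 ltxx.
rewrite -leNgt => h.
have := sqr_ge0 (x.1 - y1); have := sqr_ge0 (x.2 - y2) => h2 h1.
have /eqP : (x.1 - y1) ^+ 2 = 0 by apply/eqP; rewrite eq_le h1 andbT; lra.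
have /eqP : (x.2 - y2) ^+ 2 = 0 by apply/eqP; rewrite eq_le h2 andbT; lra.
by rewrite !sqrf_eq0 !subr_eq0 => /eqP -> /eqP ->.
Qed.

End plane.

Theorem theorem9p1 (R : realType) (Ups H : R * R -> R) (beta : R) :
  standing Ups H -> beta < 0 ->
  forall rho1 rho2 : R * R -> R,
    is_solution Ups H beta rho1 -> is_solution Ups H beta rho2 ->
    {ae @leb2 R, forall x, rho1 x = rho2 x}.
Proof.
move=> [_ [Ups0 _] _ _ _] b0 rho1 rho2 sol1 sol2.
pose m2 := prod_sfm (@lebesgue_measure R) (@lebesgue_measure R).
pose X := (measurableTypeR R * measurableTypeR R)%type.
have solP rho : is_solution Ups H beta rho ->
    @gas_solution _ _ R m2 (fst : X -> R) (snd : X -> R) Ups H beta rho.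
  by case=> ? ? ? [_ ?] ?; split.
have mfst : measurable_fun setT (fst : X -> R) by exact: measurable_fst.
have msnd : measurable_fun setT (snd : X -> R) by exact: measurable_snd.
have mexpR : measurable_fun setT (@expR R : measurableTypeR R -> R).
  exact: measurable_expR.
exact: (@gas_solution_unique _ _ R m2 _ _ Ups H beta mfst msnd
  (ae_sqdist_gt0 R) _ _ _ _ mexpR (@expR_gt0 R) (@frullani_expR R) rho1 rho2
  Ups0 b0 (solP _ sol1) (solP _ sol2)).
Qed.
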